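(* Let $(V,\leq)$ be a topological vector lattice and let $(\mathcal{K}_\alpha)_{\alpha>0}$ be a family of subsets of $V$ such that $ax+by\in\mathcal{K}_{a\alpha+b\beta}$ for all $a,b\in\mathbb{R}_+$, $\alpha,\beta>0$ with $a\alpha+b\beta>0$ and all $x\in\mathcal{K}_\alpha$, $y\in\mathcal{K}_\beta$. Let $\mathcal{B}:=(\mathcal{K}_1-V_+)\cap V_+$. Then the following statements are equivalent: (i) $\mathcal{K}_1$ satisfies NUPBR. (ii) $\mathcal{K}_1$ satisfies NAA$_1$. (iii) For each neighborhood $U\subset V$ of zero there exists $\alpha\in(0,1)$ such that $\{x\in V: p_{\mathcal{B}}(x)\leq\alpha\}\cap V_+\subset U\cap V_+$. If these conditions are fulfilled, then $\mathcal{K}_1$ satisfies NA$_1$.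
   Context: A topological vector lattice $(V,\leq)$ is a real vector lattice $V$ which is a Hausdorff topological vector space having a neighborhood basis of zero consisting of solid sets ($A$ is solid if $x\in A$, $y\in V$, $|y|\leq|x|$ imply $y\in A$). $V_+:=\{x\in V:x\geq 0\}$ and $\mathbb{R}_+=[0,\infty)$. A subset $\mathcal{B}\subset V$ is topologically bounded if for every neighborhood $U$ of zero there is $\alpha>0$ with $\mathcal{B}\subset\alpha U$. It is sequentially bounded if for every sequence $(x_n)\subset\mathcal{B}$ and every real sequence $\alpha_n\to0$ we have $\alpha_nx_n\to0$. The Minkowski functional is $p_{\mathcal{B}}:V\to[0,\infty]$, $p_{\mathcal{B}}(x):=\inf\{\alpha>0:x\in\alpha\mathcal{B}\}$ (with $\inf\emptyset=\infty$). For $\mathcal{B}:=(\mathcal{K}_1-V_+)\cap V_+$: $\mathcal{K}_1$ satisfies NUPBR if $\mathcal{B}$ is topologically bounded; NAA$_1$ if $\mathcal{B}$ is sequentially bounded; NA$_1$ if $p_{\mathcal{B}}(x)>0$ for all $x\in V_+\setminus\{0\}$. *)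

(* Defs.v *)
From HB Require Import structures.
From mathcomp Require Import all_boot all_order all_algebra.
From mathcomp Require Import all_classical all_reals all_analysis.

Set Implicit Arguments.
Unset Strict Implicit.
Unset Printing Implicit Defensive.

Import Order.TTheory GRing.Theory Num.Theory.
Import numFieldNormedType.Exports.

Local Open Scope classical_set_scope.
Local Open Scope ring_scope.

(* A join of Order.Lattice and GRing.Zmodule cannot be declared on top of the
   existing hierarchy (Num.RealDomain already inherits from both), so the lattice
   operations are specified here over the library partial order. *)
HB.mixin Record isVectorLattice (R : numDomainType) V
    & Num.POrderedZmodule V & GRing.Lmodule R V := {
  vjoin : V -> V -> V ;
  vmeet : V -> V -> V ;
  ge_vjoin : forall x y z : V, (vjoin x y <= z) = (x <= z) && (y <= z) ;
  le_vmeet : forall x y z : V, (z <= vmeet x y) = (z <= x) && (z <= y) ;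
  vlat_leD2r : forall z x y : V, x <= y -> x + z <= y + z ;
  vlat_leZ : forall (a : R) (x y : V), 0 <= a -> x <= y -> a *: x <= a *: y
}.

#[short(type="vectorLatticeType")]
HB.structure Definition VectorLattice (R : numDomainType) :=
  {V of Num.POrderedZmodule V & GRing.Lmodule R V & isVectorLattice R V}.

Definition vabs {R : numDomainType} {V : vectorLatticeType R} (x : V) : V :=
  vjoin x (- x).

Definition solid {R : numDomainType} {V : vectorLatticeType R}
    (A : set V) : Prop :=
  forall x y : V, A x -> vabs y <= vabs x -> A y.

HB.structure Definition PreTopVectorLattice (R : numDomainType) :=
  {V of VectorLattice R V & TopologicalLmodule R V}.

HB.mixin Record isTopVectorLattice (R : numDomainType) V
    & PreTopVectorLattice R V := {
  vlat_hausdorff : hausdorff_space V ;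
  vlat_solid_basis : forall U : set V, nbhs (0 : V) U ->
    exists A : set V, [/\ nbhs (0 : V) A, solid A & A `<=` U]
}.

#[short(type="topVectorLatticeType")]
HB.structure Definition TopVectorLattice (R : numDomainType) :=
  {V of PreTopVectorLattice R V & isTopVectorLattice R V}.

Section Notions.
Context {R : realType} {V : topVectorLatticeType R}.
Implicit Types (K B U : set V) (x : V).

Definition poscone : set V := [set x | 0 <= x].

Definition scale_set (a : R) B : set V := [set a *: x | x in B].

Definition topologically_bounded B : Prop :=
  forall U, nbhs (0 : V) U -> exists2 a : R, 0 < a & B `<=` scale_set a U.

Definition sequentially_bounded B : Prop :=
  forall (x : nat -> V) (a : nat -> R), (forall n, B (x n)) ->
    a n @[n --> \oo] --> (0 : R) -> a n *: x n @[n --> \oo] --> (0 : V).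

(* ereal_inf set0 = +oo, as in the convention inf of the empty set. *)
Definition minkowski_fun B x : \bar R :=
  ereal_inf [set a%:E | a in [set a : R | 0 < a /\ scale_set a B x]].

Definition posdom K : set V :=
  [set k - v | k in K & v in poscone] `&` poscone.

Definition NUPBR K : Prop := topologically_bounded (posdom K).

Definition NAA1 K : Prop := sequentially_bounded (posdom K).

Definition NA1 K : Prop :=
  forall x, poscone x -> x <> 0 -> (0 < minkowski_fun (posdom K) x)%E.

End Notions.

(* Main.v *)
(* Only B in V_+ and the solidity of the neighbourhoods of zero matter: if A is
   solid, x in A and |c| <= 1 give c x in A, so boundedness absorbs vanishing
   scalars; conversely an unbounded B yields x_n in B outside n U, for which
   x_n / n cannot tend to zero. Condition (iii) is a rescaling of
   boundedness, and under it p_B(x) = 0 puts x in every neighbourhood of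
   zero. *)
Require Import Defs.
From HB Require Import structures.
From mathcomp Require Import all_boot all_order all_algebra.
From mathcomp Require Import all_classical all_reals all_analysis.

Import Order.TTheory GRing.Theory Num.Theory.
Import numFieldNormedType.Exports.

Local Open Scope classical_set_scope.
Local Open Scope ring_scope.

Section SolidSets.
Context {R : realType} {V : topVectorLatticeType R}.
Implicit Types (x : V) (A B U : set V) (a c : R).

Lemma vabs_ge x : x <= vabs x.
Proof. by have := lexx (vabs x); rewrite {1}/vabs ge_vjoin => /andP[]. Qed.

Lemma vabs_geN x : - x <= vabs x.
Proof. by have := lexx (vabs x); rewrite {1}/vabs ge_vjoin => /andP[]. Qed.

Lemma vlat_leD (x y z t : V) : x <= y -> z <= t -> x + z <= y + t.
Proof.
move=> xy zt; apply: (le_trans (vlat_leD2r z _ _ xy)).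
by rewrite ![y + _]addrC; exact: vlat_leD2r.
Qed.

(** Adding [x <= vabs x] and [- x <= vabs x] gives [0 <= 2 *: vabs x], which is then halved. *)
Lemma vabs_ge0 x : 0 <= vabs x.
Proof.
have h : 0 <= (2 : R) *: vabs x.
  by rewrite scaler_nat mulr2n -(subrr x) vlat_leD ?vabs_ge ?vabs_geN.
have := vlat_leZ (2^-1 : R) _ _ _ h.
by rewrite scaler0 scalerA mulVf ?pnatr_eq0// scale1r; apply; rewrite invr_ge0.
Qed.

Lemma vlat_scale_ge0 c x : 0 <= c -> 0 <= x -> 0 <= c *: x.
Proof. by move=> c0 x0; have := vlat_leZ c _ _ c0 x0; rewrite scaler0. Qed.

Lemma vlat_scale_le c x : c <= 1 -> 0 <= x -> c *: x <= x.
Proof.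
move=> c1 x0; have := vlat_scale_ge0 (1 - c) x.
rewrite subr_ge0 => /(_ c1 x0)/(vlat_leD2r (c *: x)).
by rewrite add0r scalerBl scale1r subrK.
Qed.

Lemma vabs_scale_le c x : `|c| <= 1 -> vabs (c *: x) <= vabs x.
Proof.
move=> c1; have cx : `|c| *: vabs x <= vabs x.
  exact: vlat_scale_le c1 (vabs_ge0 x).
have px : `|c| *: x <= vabs x.
  exact: le_trans (vlat_leZ _ _ _ (normr_ge0 c) (vabs_ge x)) cx.
have nx : - (`|c| *: x) <= vabs x.
  rewrite -scalerN.
  exact: le_trans (vlat_leZ _ _ _ (normr_ge0 c) (vabs_geN x)) cx.
(* The elements [c *: x] and [- (c *: x)] are [|c| *: x] and its opposite, in an order set by the
   sign of [c]. *)
rewrite {1}/vabs ge_vjoin; case: (ger0P c) px nx => c0.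
  by move=> -> ->.
by rewrite !scaleNr opprK => -> ->.
Qed.

(** Solid sets are balanced; solidity enters the boundedness arguments in this form. *)
Lemma solid_scale A c x : solid A -> `|c| <= 1 -> A x -> A (c *: x).
Proof. by move=> sA c1 Ax; apply: (sA x) => //; exact: vabs_scale_le. Qed.

Lemma topologically_bounded_sequentially B :
  topologically_bounded B -> sequentially_bounded B.
Proof.
move=> bB x a Bx a0 U /vlat_solid_basis[A [nA sA AU]].
have [b b0 BA] := bB A nA.
(* Points of [B] are [b *: u] with [u] in [A], so [|a n| <= b^-1] is what makes the total factor
   [a n * b] at most 1 in absolute value. *)
have /cvgrPdist_le/(_ b^-1) := a0; rewrite invr_gt0 => /(_ b0).
apply: filterS => n; rewrite /= sub0r normrN => an.
have [u Au <-] := BA _ (Bx n).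
apply: AU; rewrite scalerA; apply: solid_scale => //.
by rewrite normrM (gtr0_norm b0) -ler_pdivlMr// div1r.
Qed.

Lemma sequentially_bounded_topologically B :
  sequentially_bounded B -> topologically_bounded B.
Proof.
move=> sB U nU; apply: contrapT => nb.
(* The shift to [n.+1] keeps the scale positive and matches [harmonic], whose terms are
   [n.+1%:R^-1]. *)
have hx (n : nat) : exists y, B y /\ ~ scale_set n.+1%:R U y.
  apply: contrapT => hn; apply: nb; exists n.+1%:R => // y By.
  by apply: contrapT => Uy; apply: hn; exists y.
have [x hxP] := choice hx.
have Bx n : B (x n) by case: (hxP n).
(* One index suffices for the contradiction: the threshold [N] itself. *)
have [N _ /(_ N (leqnn N)) UN] := sB x harmonic Bx cvg_harmonic U nU.
case: (hxP N) => _; apply; exists (N.+1%:R^-1 *: x N) => //.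
by rewrite scalerA divff ?pnatr_eq0// scale1r.
Qed.

Lemma minkowski_fun_scale_le B a x : 0 < a -> B x ->
  (minkowski_fun B (a *: x) <= a%:E)%E.
Proof.
by move=> a0 Bx; apply: ereal_inf_lbound; exists a => //; split=> //; exists x.
Qed.

(** The infimum need not be attained, hence the strict bound in the hypothesis. *)
Lemma minkowski_fun_lt B x (b : R) : (minkowski_fun B x < b%:E)%E ->
  exists c, [/\ 0 < c, c < b & scale_set c B x].
Proof.
by move=> /ereal_inf_lt[_ [c [c0 cBx] <-]]; rewrite lte_fin; exists c.
Qed.

Lemma topologically_bounded_minkowski B : B `<=` poscone ->
  topologically_bounded B <->
  forall U, nbhs (0 : V) U -> exists2 alpha : R, 0 < alpha < 1 &
    [set x | (minkowski_fun B x <= alpha%:E)%E] `&` poscone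
      `<=` U `&` poscone.
Proof.
move=> Bpos; split=> [bB U /vlat_solid_basis[A [nA sA AU]]|hB U nU].
  have [a a0 BA] := bB A nA.
  have a1 : 0 < 1 + a by rewrite addr_gt0.
  have p0 : 0 < (1 + a)^-1 by rewrite invr_gt0.
  (* Using [1 + a] instead of [a] keeps the constant below 1; the half makes room for the strict
     inequality [p_B(x) < (1 + a)^-1]. The scale [c] so obtained satisfies [c * a <= 1]. *)
  exists ((1 + a)^-1 / 2).
    rewrite divr_gt0//= ltr_pdivrMr// mul1r (@lt_trans _ _ 1) ?ltr1n//.
    by rewrite invf_lt1// ltrDl.
  move=> x [/= px x0]; split=> //; apply: AU.
  have [|c [c0 cb [y By <-]]] := @minkowski_fun_lt B x (1 + a)^-1.
    by apply: le_lt_trans px _; rewrite lte_fin ltr_pdivrMr// ltr_pMr// ltr1n.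
  have [u Au <-] := BA _ By.
  rewrite scalerA; apply: solid_scale => //.
  rewrite gtr0_norm ?mulr_gt0// -ler_pdivlMr// div1r.
  by rewrite (le_trans (ltW cb))// lef_pV2 ?posrE// lerDr.
have [c /andP[c0 _] cU] := hB U nU.
(* For [x] in [B], the point [c *: x] is positive and its Minkowski functional is at most [c], so it
   lies in [U]. *)
exists c^-1; first by rewrite invr_gt0.
move=> x Bx; exists (c *: x); last first.
  by rewrite scalerA mulVf ?gt_eqF// scale1r.
have [|//] := cU (c *: x); split; first exact: minkowski_fun_scale_le.
by apply: vlat_scale_ge0; [exact: ltW|exact: Bpos].
Qed.

Lemma topologically_bounded_minkowski_gt0 B x : B `<=` poscone ->
  topologically_bounded B -> poscone x -> x <> 0 -> (0 < minkowski_fun B x)%E.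
Proof.
move=> /topologically_bounded_minkowski -> hB x0 xN0.
rewrite ltNge; apply/negP => px; apply: xN0; apply/esym.
(* Separation reduces [0 = x] to every neighbourhood of 0 meeting every neighbourhood of [x]; the
   common point is [x] itself, as [p_B(x) <= 0] lies below every threshold. *)
apply: (@vlat_hausdorff R V) => A U nA nU.
exists x; split; last exact: nbhs_singleton.
have [c /andP[c0 _] cA] := hB A nA.
have [|//] := cA x; split=> //=.
by apply: le_trans px _; rewrite lee_fin ltW.
Qed.

End SolidSets.

Theorem proposition3p16 (R : realType) (V : topVectorLatticeType R)
    (K : R -> set V)
    (hK : forall (a b alpha beta : R) (x y : V),
        0 <= a -> 0 <= b -> 0 < alpha -> 0 < beta ->
        0 < a * alpha + b * beta ->
        K alpha x -> K beta y ->
        K (a * alpha + b * beta) (a *: x + b *: y)) :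
  let B := posdom (K 1) in
  let cond_iii := forall U : set V, nbhs (0 : V) U ->
    exists2 alpha : R, 0 < alpha < 1 &
      [set x : V | (minkowski_fun B x <= alpha%:E)%E] `&` poscone
        `<=` U `&` poscone in
  [/\ NUPBR (K 1) <-> NAA1 (K 1),
      NUPBR (K 1) <-> cond_iii
    & NUPBR (K 1) -> NA1 (K 1)].
Proof.
move=> B cond_iii.
have Bpos : B `<=` poscone by move=> x [].
split; last by move=> bB x; exact: topologically_bounded_minkowski_gt0.
- split; first exact: topologically_bounded_sequentially.
  exact: sequentially_bounded_topologically.
- exact: topologically_bounded_minkowski.
Qed.
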